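(* Let $b>a>0$, $q\ge1$, let $m,\ell\in\mathbb{R}$ with $m>0$ and $m\ge2\ell\ge0$, and let $s\in\mathbb{R}$. (1) If either $s>1$ and $(s-1)q\ge1$, or $s<1$ and $s\ne0$, then $$\left|\frac{2\ell A(a^s,b^s)+(m-2\ell)[A(a,b)]^s}m-[L_s(a,b)]^s\right|\le\frac{b-a}{8m^2}\left(\frac1{3m}\right)^{1/q}\big[4\ell^2+(m-2\ell)^2\big]^{1-1/q}|s|$$ $$\times\Big\{\Big[\big(4\ell^3+(m+\ell)(m-2\ell)^2\big)a^{(s-1)q}+\big(4(3m-\ell)\ell^2+(2m-\ell)(m-2\ell)^2\big)b^{(s-1)q}\Big]^{1/q}$$ $$+\Big[\big(4(3m-\ell)\ell^2+(2m-\ell)(m-2\ell)^2\big)a^{(s-1)q}+\big(4\ell^3+(m+\ell)(m-2\ell)^2\big)b^{(s-1)q}\Big]^{1/q}\Big\}$$ and $$\left|\frac{2\ell A(a^s,b^s)+(m-2\ell)[A(a,b)]^s}m-[L_s(a,b)]^s\right|\le\frac{b-a}{4m}|s|\left[\frac1{2m^2(q+1)(q+2)}\right]^{1/q}$$ $$\times\Big\{\Big[\big((2\ell)^{q+2}+(mq+m+2\ell)(m-2\ell)^{q+1}\big)a^{(s-1)q}+\big((2mq+4m-2\ell)(2\ell)^{q+1}+(mq+3m-2\ell)(m-2\ell)^{q+1}\big)b^{(s-1)q}\Big]^{1/q}$$ $$+\Big[\big((2mq+4m-2\ell)(2\ell)^{q+1}+(mq+3m-2\ell)(m-2\ell)^{q+1}\big)a^{(s-1)q}+\big((2\ell)^{q+2}+(mq+m+2\ell)(m-2\ell)^{q+1}\big)b^{(s-1)q}\Big]^{1/q}\Big\}.$$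 (2) If $s=-1$, then $$\left|\frac1m\left[\frac{2\ell}{H(a,b)}+\frac{m-2\ell}{A(a,b)}\right]-\frac1{L(a,b)}\right|\le\frac{b-a}{8m^2}\left(\frac1{3m}\right)^{1/q}\big[4\ell^2+(m-2\ell)^2\big]^{1-1/q}$$ $$\times\left\{\left[\frac{4\ell^3+(m+\ell)(m-2\ell)^2}{a^{2q}}+\frac{4(3m-\ell)\ell^2+(2m-\ell)(m-2\ell)^2}{b^{2q}}\right]^{1/q}+\left[\frac{4(3m-\ell)\ell^2+(2m-\ell)(m-2\ell)^2}{a^{2q}}+\frac{4\ell^3+(m+\ell)(m-2\ell)^2}{b^{2q}}\right]^{1/q}\right\}$$ and $$\left|\frac1m\left[\frac{2\ell}{H(a,b)}+\frac{m-2\ell}{A(a,b)}\right]-\frac1{L(a,b)}\right|\le\frac{b-a}{4m}\left[\frac1{2m^2(q+1)(q+2)}\right]^{1/q}$$ $$\times\left\{\left[\frac{(2\ell)^{q+2}+(mq+m+2\ell)(m-2\ell)^{q+1}}{a^{2q}}+\frac{(mq+3m-2\ell)(m-2\ell)^{q+1}+(2mq+4m-2\ell)(2\ell)^{q+1}}{b^{2q}}\right]^{1/q}\right.$$ $$\left.+\left[\frac{(2mq+4m-2\ell)(2\ell)^{q+1}+(mq+3m-2\ell)(m-2\ell)^{q+1}}{a^{2q}}+\frac{(2\ell)^{q+2}+(mq+m+2\ell)(m-2\ell)^{q+1}}{b^{2q}}\right]^{1/q}\right\}.$$ In particular (taking $q=1$), if $s\ge2$, or $s<1$ and $s\neq0$,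 then $$\left|\frac{2\ell A(a^s,b^s)+(m-2\ell)[A(a,b)]^s}m-[L_s(a,b)]^s\right|\le\frac{b-a}{4m^2}|s|\big[4\ell^2+(m-2\ell)^2\big]A\big(a^{s-1},b^{s-1}\big),$$ and $$\left|\frac1m\left[\frac{2\ell}{H(a,b)}+\frac{m-2\ell}{A(a,b)}\right]-\frac1{L(a,b)}\right|\le\frac{b-a}{4m^2}\cdot\frac{4\ell^2+(m-2\ell)^2}{H(a^2,b^2)}.$$
   Context: For positive numbers $a,b$: $A(a,b)=\frac{a+b}2$; $H(a,b)=\frac{2ab}{a+b}$; $L(a,b)=\frac{b-a}{\ln b-\ln a}$ if $a\ne b$ and $L(a,a)=a$; $I(a,b)=\frac1e\left(\frac{b^b}{a^a}\right)^{1/(b-a)}$ if $a\ne b$ and $I(a,a)=a$; and the generalized logarithmic mean is, for $a\neq b$, $L_s(a,b)=\left[\frac{b^{s+1}-a^{s+1}}{(s+1)(b-a)}\right]^{1/s}$ if $s\ne0,-1$, $L_{-1}(a,b)=L(a,b)$, $L_0(a,b)=I(a,b)$, while $L_s(a,a)=a$. *)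

(* Defs.v *)
From mathcomp Require Import all_boot all_order all_algebra.
From mathcomp Require Import reals sequences exp.

Set Implicit Arguments.
Unset Strict Implicit.
Unset Printing Implicit Defensive.

Import Order.TTheory GRing.Theory Num.Theory.

Local Open Scope ring_scope.

(* The means below are total functions on the reals; they have their usual
   meaning for positive arguments. Real powers are [powR], for which
   0 `^ x = 0 as soon as x != 0. *)

Definition arith_mean (R : realType) (a b : R) : R := (a + b) / 2.

Definition harm_mean (R : realType) (a b : R) : R := (2 * a * b) / (a + b).

Definition log_mean (R : realType) (a b : R) : R :=
  if a == b then a else (b - a) / (ln b - ln a).

Definition identric_mean (R : realType) (a b : R) : R :=
  if a == b then a
  else (expR 1)^-1 * ((b `^ b) / (a `^ a)) `^ (1 / (b - a)).

Definition gen_log_mean (R : realType) (s a b : R) : R :=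
  if a == b then a
  else if s == -1 then log_mean a b
  else if s == 0 then identric_mean a b
  else ((b `^ (s + 1) - a `^ (s + 1)) / ((s + 1) * (b - a))) `^ (1 / s).

(* Main.v *)
Require Import Defs.
From mathcomp Require Import all_boot all_order all_algebra.
From mathcomp Require Import reals sequences exp.
From mathcomp Require Import ring lra.
From mathcomp Require Import boolp classical_sets interval_inference.
From mathcomp Require Import topology normedtype derive realfun convex hoelder.

Set Implicit Arguments.
Unset Strict Implicit.
Unset Printing Implicit Defensive.

Import Order.TTheory GRing.Theory Num.Theory.
Import numFieldNormedType.Exports.

Local Open Scope ring_scope.

(** Put f x = x ^ s and c = l / m, and let F be a primitive of f.  Integrating
    by parts on [a, (a + b) / 2] and on [(a + b) / 2, b] gives
<<
      c (f a + f b) + (1 - 2 c) f ((a + b) / 2) - (F b - F a) / (b - a)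
    = (b - a) int_0^(1/2) (t - c)
                  (f' ((1 - t) a + t b) - f' ((1 - t) b + t a)) dt
>>
    and (F b - F a) / (b - a) is the s-th power of the generalized logarithmic
    mean, so the left-hand side is the quantity to be bounded.  Under the
    hypotheses on s and q, the function |f'| ^ q is convex, because its exponent
    (s - 1) q lies outside of ]0, 1[; it is thus at most its chord.

    Hoelder's inequality bounds each half by
<<
      (int |t - c| ^ al dt) ^ (1 - 1/q)
        * (int |t - c| ^ be |f'| ^ q dt) ^ (1/q)
>>
    for any splitting |t - c| = |t - c| ^ ((1 - 1/q) al) |t - c| ^ (be/q).  The
    choice al = be = 1 (power mean) gives the first family of estimates, and
    al = 0, be = q the second one.  What remains is the value of the moments
    [kernel_mass] and [kernel_moment] of |t - c| ^ p on [0, 1/2].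

    No integral is formed.  Every integrand has an explicit primitive, and an
    inequality between integrals is an inequality between increments of
    primitives ([le_increment]).  Hoelder's inequality is obtained by
    integrating Young's inequality with a free scale mu ([young_powers]) and
    then optimising over mu ([optimise_scale]); this way the only functions to
    be integrated are powers of |t - c| ([hoelder_increment]).

    The estimates for s = -1 and for q = 1 are specialisations. *)

(** * Comparison of increments *)

(** The derivative of a power is only available at positive points; continuity
    at 0 is what allows the mean value theorem to reach the zero of t - c. *)
Lemma powR_within_continuous (R : realType) (p d : R) : 0 < p -> 0 < d ->
  {within `[0, d], continuous (fun v : R => v `^ p)}%classic.
Proof.
move=> p0 d0.
have cont (x : R) : 0 < x -> {for x, continuous (fun v : R => v `^ p)}.
  move=> x0; apply/differentiable_continuous/derivable1_diffP.
  by apply: derivable_powR; rewrite in_itv/= x0.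
apply/continuous_within_itvP => //; split.
- by move=> x; rewrite in_itv/= => /andP[x0 _]; exact: cont.
- by rewrite powR0 ?gt_eqF//; exact: powR_cvg0.
- by apply: cvg_at_left_filter; exact: cont.
Qed.

(** The inequality of integrals | int P' | <= int g, with G a primitive of g.
    Nothing is assumed on the derivatives at the endpoints, where those of
    fractional powers need not exist. *)
Lemma le_increment (R : realType) (P dP G g : R -> R) (d : R) : 0 <= d ->
  {within `[0, d], continuous P}%classic ->
  {within `[0, d], continuous G}%classic ->
  (forall v : R, 0 < v < d -> is_derive v 1 P (dP v)) ->
  (forall v : R, 0 < v < d -> is_derive v 1 G (g v)) ->
  (forall v : R, 0 < v < d -> `|dP v| <= g v) ->
  `|P d - P 0| <= G d - G 0.
Proof.
move=> d0 cP cG dP' dG Pg.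
move: d0; rewrite le_eqVlt => /predU1P[<-|d0]; first by rewrite !subrr normr0.
have mono (e : R) : `|e| = 1 -> e * (P d - P 0) <= G d - G 0.
  move=> e1.
  pose E : R -> R := fun v => G v - e * P v.
  have cE : {within `[0, d], continuous E}%classic.
    move=> x; apply: cvgB; first exact: cG.
    by apply: cvgM; [exact: cvg_cst|exact: cP].
  have dE v : v \in `]0, d[ -> is_derive v 1 E (g v - e * dP v).
    rewrite in_itv/= => v0.
    exact: (is_deriveB (dG _ v0) (is_deriveZ e (dP' _ v0))).
  have [v] := MVT d0 dE cE.
  rewrite in_itv/= => v0 Ev.
  rewrite -subr_ge0.
  have -> : G d - G 0 - e * (P d - P 0) = E d - E 0 by rewrite /E; ring.
  rewrite Ev subr0 mulr_ge0 ?(ltW d0)// subr_ge0.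
  by rewrite (le_trans (ler_norm _))// normrM e1 mul1r Pg.
rewrite ler_norml; apply/andP; split.
  by rewrite lerNl -mulN1r mono// normrN1.
by rewrite -[X in X <= _]mul1r mono// normr1.
Qed.

(** * Hoelder's inequality through a free scale *)

(** Young's inequality u ^ (1 - 1/q) v ^ (1/q) <= (1 - 1/q) u + v / q for
    u = mu k ^ al and v = mu ^ (1 - q) k ^ be y ^ q: the condition on al and be
    makes the left-hand side equal to k y, whatever the scale mu.  It also
    forces be = 1 when q = 1, and there the two sides agree. *)
Lemma young_powers (R : realType) (q al be mu k y : R) : 1 <= q ->
  (1 - 1 / q) * al + be / q = 1 -> 0 < mu -> 0 < k -> 0 <= y ->
  k * y <= (1 - 1 / q) * mu * k `^ al
           + 1 / q * (mu `^ (1 - q) * (k `^ be * y `^ q)).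
Proof.
move=> q1 albe mu0 k0 y0.
have q0 : 0 < q by exact: lt_le_trans q1.
move: q1; rewrite le_eqVlt => /predU1P[q1|q1].
  subst q; move: albe; rewrite !divr1 subrr !mul0r add0r => ->.
  by rewrite powRr0 add0r !mul1r powRr1 ?(ltW k0)// powRr1.
have q10 : 0 < q - 1 by rewrite subr_gt0.
have hp : (q / (q - 1))^-1 = 1 - 1 / q by field; rewrite !gt_eqF.
have hp0 : 0 < 1 - 1 / q by rewrite -hp invr_gt0 divr_gt0.
set u := mu * k `^ al.
set v := mu `^ (1 - q) * (k `^ be * y `^ q).
have u0 : 0 <= u by rewrite mulr_ge0 ?powR_ge0// ltW.
have v0 : 0 <= v by rewrite !mulr_ge0 ?powR_ge0.
have -> : k * y = u `^ (1 - 1 / q) * v `^ (1 / q).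
  rewrite /u /v !powRM ?powR_ge0 ?mulr_ge0 ?powR_ge0// ?(ltW mu0)//.
  rewrite -!powRrM.
  have -> : q * (1 / q) = 1 by field; rewrite gt_eqF.
  rewrite powRr1//.
  have -> (w x y' z : R) :
      w * x * (y' * (z * y)) = (w * y') * (x * z) * y by ring.
  rewrite -!powRD ?(gt_eqF mu0) ?(gt_eqF k0) ?implybT//.
  have -> : 1 - 1 / q + (1 - q) * (1 / q) = 0 by field; rewrite gt_eqF.
  have -> : al * (1 - 1 / q) + be * (1 / q) = 1.
    by rewrite -[RHS]albe; field; rewrite gt_eqF.
  by rewrite powRr0 mul1r powRr1 ?ltW.
have hq0 : 0 < q / (q - 1) by rewrite divr_gt0.
have := conjugate_powR (powR_ge0 u (1 - 1 / q)) (powR_ge0 v (1 / q)) hq0 q0.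
rewrite hp -!powRrM -hp mulVf ?gt_eqF// div1r mulVf ?gt_eqF// !powRr1//.
rewrite hp div1r subrK => /(_ erefl) /le_trans; apply.
by rewrite [X in X + _]mulrC mulrA [X in _ + X]mulrC.
Qed.

(** The minimum over mu is reached at mu = (X / M) ^ (1/q), where both terms are
    proportional to the right-hand side. *)
Lemma optimise_scale (R : realType) (q M X Z : R) : 1 <= q -> 0 < M -> 0 < X ->
  (forall mu, 0 < mu ->
    Z <= (1 - 1 / q) * mu * M + 1 / q * (mu `^ (1 - q) * X)) ->
  Z <= M `^ (1 - 1 / q) * X `^ (1 / q).
Proof.
move=> q1 M0 X0 H.
have q0 : 0 < q by exact: lt_le_trans q1.
apply: le_trans (H ((X / M) `^ (1 / q)) _) _.
  by rewrite powR_gt0 ?divr_gt0.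
have XM r : (X / M) `^ r = X `^ r * M `^ (- r).
  by rewrite powRM ?invr_ge0 ?ltW// -powR_inv1 ?ltW// -powRrM mulN1r.
rewrite -powRrM !XM.
have -> : (1 - 1 / q) * (X `^ (1 / q) * M `^ (- (1 / q))) * M
        = (1 - 1 / q) * (M `^ (1 - 1 / q) * X `^ (1 / q)).
  rewrite powRD ?(gt_eqF M0) ?implybT// powRr1 ?(ltW M0)//.
  by ring.
have -> : X `^ (1 / q * (1 - q)) * M `^ (- (1 / q * (1 - q))) * X
        = M `^ (1 - 1 / q) * X `^ (1 / q).
  have -> : - (1 / q * (1 - q)) = 1 - 1 / q by field; rewrite gt_eqF.
  have -> : X `^ (1 / q) = X `^ (1 / q * (1 - q)) * X.
    rewrite -[X in _ = _ * X](powRr1 (ltW X0)) -powRD ?(gt_eqF X0) ?implybT//.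
    by congr (_ `^ _); field; rewrite gt_eqF.
  by ring.
by rewrite -mulrDl subrK mul1r.
Qed.

(** * Moments of the kernel on the half interval *)
Lemma is_derive_powR_prim (R : realType) (p v : R) : 0 <= p -> 0 < v ->
  is_derive v 1 (fun v : R => v `^ (p + 1) / (p + 1)) (v `^ p).
Proof.
move=> p0 v0.
have H := is_derive1_powR (p + 1) v0.
have := is_deriveZ (p + 1)^-1 H.
rewrite /GRing.scale/= addrK mulrA mulVf ?gt_eqF ?ltr_wpDl// mul1r.
congr is_derive.
by apply/funext => x; exact: mulrC.
Qed.

(** One side of the zero of the kernel: v is the distance to that zero, and
    C + D v is the chord lying above |h| ^ q. *)
Lemma hoelder_increment (R : realType) (q al be mu C D d : R)
    (P dP h : R -> R) :
  1 <= q -> 0 <= al -> 0 <= be -> (1 - 1 / q) * al + be / q = 1 -> 0 < mu ->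
  0 <= d ->
  (forall v : R, 0 <= v <= d -> is_derive v 1 P (dP v)) ->
  (forall v : R, 0 < v < d -> `|dP v| = v * `|h v|) ->
  (forall v : R, 0 < v < d -> `|h v| `^ q <= C + D * v) ->
  `|P d - P 0| <=
    (1 - 1 / q) * mu * (d `^ (al + 1) / (al + 1))
    + 1 / q * (mu `^ (1 - q) * (C * (d `^ (be + 1) / (be + 1))
                                + D * (d `^ (be + 1 + 1) / (be + 1 + 1)))).
Proof.
move=> q1 al0 be0 albe mu0 d0 derP dPh hCD.
have be1 : 0 <= be + 1 by rewrite addr_ge0.
move: d0; rewrite le_eqVlt => /predU1P[d0|d0].
  rewrite -d0 subrr normr0 !powR0 ?gt_eqF ?ltr_wpDl//.
  by rewrite !(mul0r, mulr0, addr0).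
have q0 : 0 < q by exact: lt_le_trans q1.
pose I p : R -> R := fun v => v `^ (p + 1) / (p + 1).
have I0 p : 0 <= p -> I p 0 = 0.
  by move=> p0; rewrite /I powR0 ?mul0r// gt_eqF// ltr_wpDl.
have cI p : 0 <= p -> {within `[0, d], continuous (I p)}%classic.
  move=> p0; have p10 : 0 < p + 1 by rewrite ltr_wpDl.
  have cp := powR_within_continuous p10 d0.
  by move=> x; exact: (cvgM (cp x) (cvg_cst (p + 1)^-1)).
pose G : R -> R := fun v => (1 - 1 / q) * mu * I al v
  + 1 / q * (mu `^ (1 - q) * (C * I be v + D * I (be + 1) v)).
pose g : R -> R := fun v => (1 - 1 / q) * mu * v `^ al
  + 1 / q * (mu `^ (1 - q) * (C * v `^ be + D * v `^ (be + 1))).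
have G0 : G 0 = 0 by rewrite /G !I0// !(mulr0, addr0).
have cP : {within `[0, d], continuous P}%classic.
  apply: derivable_within_continuous => v; rewrite in_itv/= => vd.
  by have [] := derP v vd.
have cG : {within `[0, d], continuous G}%classic.
  have c1 := cI al al0; have c2 := cI be be0; have c3 := cI (be + 1) be1.
  move=> x; apply: cvgD; first exact: (cvgM (cvg_cst _) (c1 x)).
  apply: (cvgM (cvg_cst _) (cvgM (cvg_cst _) _)).
  exact: (cvgD (cvgM (cvg_cst C) (c2 x)) (cvgM (cvg_cst D) (c3 x))).
have := @le_increment R P dP G g d (ltW d0) cP cG.
rewrite G0 subr0; apply.
- by move=> v /andP[v0 vd]; apply: derP; rewrite !ltW.
- move=> v /andP[v0 _].
  have H1 := is_derive_powR_prim al0 v0.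
  have H2 := is_derive_powR_prim be0 v0.
  have H3 := is_derive_powR_prim be1 v0.
  have H4 := is_deriveZ ((1 - 1 / q) * mu) H1.
  have H5 := is_deriveD (is_deriveZ C H2) (is_deriveZ D H3).
  exact: (is_deriveD H4 (is_deriveZ (1 / q) (is_deriveZ (mu `^ (1 - q)) H5))).
- move=> v vd; rewrite dPh//; have v0 : 0 < v by case/andP: vd.
  apply: le_trans (young_powers q1 albe mu0 v0 (normr_ge0 _)) _.
  rewrite /g lerD2l ler_wpM2l ?divr_ge0 ?(ltW q0)// ler_wpM2l ?powR_ge0//.
  rewrite powRD ?(gt_eqF v0) ?implybT// powRr1 ?(ltW v0)//.
  have -> : C * v `^ be + D * (v `^ be * v) = v `^ be * (C + D * v) by ring.
  by rewrite ler_wpM2l ?powR_ge0// hCD.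
Qed.

(** The integral of |t - c| ^ p over [0, 1/2], for 0 <= c <= 1/2. *)
Definition kernel_mass (R : realType) (c p : R) : R :=
  (c `^ (p + 1) + (1 / 2 - c) `^ (p + 1)) / (p + 1).

(** The integral of t |t - c| ^ p over [0, 1/2], for 0 <= c <= 1/2. *)
Definition kernel_moment (R : realType) (c p : R) : R :=
  (c `^ (p + 2) + (1 / 2 - c) `^ (p + 1) * ((p + 1) / 2 + c))
  / ((p + 1) * (p + 2)).

Lemma kernel_mass_gt0 (R : realType) (c p : R) : 0 <= c <= 1 / 2 -> 0 <= p ->
  0 < kernel_mass c p.
Proof.
move=> /andP[c0 c1] p0; apply: divr_gt0; last by rewrite ltr_wpDl.
have [->|cn0] := eqVneq c 0.
  by rewrite subr0 ltr_wpDl ?powR_ge0// powR_gt0// divr_gt0.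
by rewrite ltr_wpDr ?powR_ge0// powR_gt0// lt0r cn0.
Qed.

Lemma kernel_moment_ge0 (R : realType) (c p : R) : 0 <= c -> 0 <= p ->
  0 <= kernel_moment c p.
Proof.
move=> c0 p0; rewrite divr_ge0 ?mulr_ge0 ?addr_ge0 ?mulr_ge0 ?powR_ge0//.
by rewrite addr_ge0 ?divr_ge0 ?addr_ge0.
Qed.

Lemma powRS (R : realType) (c p : R) : 0 <= c -> 0 <= p ->
  c `^ (p + 1) = c `^ p * c.
Proof.
by move=> c0 p0; rewrite powRD ?powRr1// gt_eqF// ltr_wpDl.
Qed.

(** The integral of (1 - t) |t - c| ^ p, which is the weight of the other
    endpoint of the chord; this form shows that it is nonnegative. *)
Lemma kernel_comomentE (R : realType) (c p : R) : 0 <= c -> 0 <= p ->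
  kernel_mass c p - kernel_moment c p =
  (c `^ (p + 1) * (p + 2 - c) + (1 / 2 - c) `^ (p + 1) * ((p + 3) / 2 - c))
  / ((p + 1) * (p + 2)).
Proof.
move=> c0 p0; have p1 : 0 <= p + 1 by rewrite addr_ge0.
rewrite /kernel_mass /kernel_moment.
have -> : p + 2 = p + 1 + 1 by ring.
rewrite (powRS c0 p1); field.
by rewrite !gt_eqF ?ltr_wpDl.
Qed.

Lemma kernel_comoment_ge0 (R : realType) (c p : R) : 0 <= c <= 1 / 2 ->
  0 <= p -> 0 <= kernel_mass c p - kernel_moment c p.
Proof.
move=> /andP[c0 c1] p0; rewrite kernel_comomentE//.
rewrite divr_ge0 ?mulr_ge0 ?addr_ge0 ?mulr_ge0 ?powR_ge0//; lra.
Qed.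

(** Hoelder's inequality for (t - c) h t on [0, 1/2], the chord (1 - t) A + t B
    replacing |h| ^ q.  The kernel changes sign at c, and the substitutions
    t = c - v and t = c + v reduce each side to [hoelder_increment] with the
    same scale mu. *)
Lemma half_bound (R : realType) (q al be c A B : R) (P h : R -> R) :
  1 <= q -> 0 <= al -> 0 <= be -> (1 - 1 / q) * al + be / q = 1 ->
  0 <= c <= 1 / 2 -> 0 < A -> 0 < B ->
  (forall t : R, 0 <= t <= 1 / 2 -> is_derive t 1 P ((t - c) * h t)) ->
  (forall t : R, 0 <= t <= 1 / 2 -> `|h t| `^ q <= (1 - t) * A + t * B) ->
  `|P (1 / 2) - P 0| <= kernel_mass c al `^ (1 - 1 / q)
    * (A * (kernel_mass c be - kernel_moment c be) + B * kernel_moment c be)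
      `^ (1 / q).
Proof.
move=> q1 al0 be0 albe c01 A0 B0 derP hAB.
have /andP[c0 c1] := c01.
have be1 : 0 <= be + 1 by rewrite addr_ge0.
have w0 : 0 <= 1 / 2 - c by rewrite subr_ge0.
have mom0 := kernel_moment_ge0 c0 be0.
have com0 := kernel_comoment_ge0 c01 be0.
apply: optimise_scale => //; first exact: kernel_mass_gt0.
  have : 0 < kernel_mass c be by exact: kernel_mass_gt0.
  have [->|mn0] := eqVneq (kernel_moment c be) 0.
    by rewrite mulr0 addr0 subr0 => ?; rewrite mulr_gt0.
  by move=> _; rewrite ltr_wpDl ?mulr_ge0 ?(ltW A0)// mulr_gt0// lt0r mn0.
move=> mu mu0.
have left : `|P 0 - P c| <= (1 - 1 / q) * mu * (c `^ (al + 1) / (al + 1))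
    + 1 / q * (mu `^ (1 - q)
               * (((1 - c) * A + c * B) * (c `^ (be + 1) / (be + 1))
                  + (A - B) * (c `^ (be + 1 + 1) / (be + 1 + 1)))).
  (* At t = c - v the chord is C + (A - B) v, where C is its value at c. *)
  have := @hoelder_increment R q al be mu ((1 - c) * A + c * B) (A - B) c
    (fun v => P (c - v)) (fun v => - (((c - v) - c) * h (c - v)))
    (fun v => h (c - v)) q1 al0 be0 albe mu0 c0.
  rewrite subrr subr0; apply.
  - move=> v /andP[v0 vc].
    have Hv : 0 <= c - v <= 1 / 2 by apply/andP; split; lra.
    have ? := derP _ Hv.
    have -> : - ((c - v - c) * h (c - v))
              = ((c - v - c) * h (c - v)) * (0 - 1) by ring.
    exact: is_derive1_comp.
  - move=> v /andP[v0 vc]; rewrite normrN normrM; congr (_ * _).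
    by rewrite addrAC subrr add0r normrN gtr0_norm.
  - move=> v /andP[v0 vc].
    have Hv : 0 <= c - v <= 1 / 2 by apply/andP; split; lra.
    apply: le_trans (hAB _ Hv) _.
    by rewrite le_eqVlt; apply/orP; left; apply/eqP; ring.
have right : `|P (1 / 2) - P c|
    <= (1 - 1 / q) * mu * ((1 / 2 - c) `^ (al + 1) / (al + 1))
    + 1 / q * (mu `^ (1 - q)
               * (((1 - c) * A + c * B) * ((1 / 2 - c) `^ (be + 1) / (be + 1))
                  + (B - A) * ((1 / 2 - c) `^ (be + 1 + 1) / (be + 1 + 1)))).
  have := @hoelder_increment R q al be mu ((1 - c) * A + c * B) (B - A)
    (1 / 2 - c) (fun v => P (c + v)) (fun v => (((c + v) - c) * h (c + v)))
    (fun v => h (c + v)) q1 al0 be0 albe mu0 w0.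
  rewrite subrKC addr0; apply.
  - move=> v /andP[v0 vc].
    have Hv : 0 <= c + v <= 1 / 2 by apply/andP; split; lra.
    have ? := derP _ Hv.
    have -> : (c + v - c) * h (c + v)
              = ((c + v - c) * h (c + v)) * (0 + 1) by ring.
    exact: is_derive1_comp.
  - move=> v /andP[v0 vc]; rewrite normrM; congr (_ * _).
    by rewrite addrAC subrr add0r gtr0_norm.
  - move=> v /andP[v0 vc].
    have Hv : 0 <= c + v <= 1 / 2 by apply/andP; split; lra.
    apply: le_trans (hAB _ Hv) _.
    by rewrite le_eqVlt; apply/orP; left; apply/eqP; ring.
have -> : P (1 / 2) - P 0 = (P (1 / 2) - P c) - (P 0 - P c) by ring.
apply: le_trans (ler_normB _ _) _.
apply: le_trans (lerD right left) _.
rewrite le_eqVlt; apply/orP; left; apply/eqP.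
rewrite kernel_comomentE// /kernel_mass /kernel_moment.
have -> : be + 2 = be + 1 + 1 by ring.
rewrite !(powRS _ be1)//.
move: (c `^ (be + 1)) ((1 / 2 - c) `^ (be + 1)) => X Y.
move: (c `^ (al + 1)) ((1 / 2 - c) `^ (al + 1)) => X' Y'.
by field; rewrite !gt_eqF ?ltr_wpDl// (lt_le_trans _ q1).
Qed.

(** * The mixed trapezoid and midpoint rule *)

(** Integration by parts of (t - c) f' on the half of the segment next to x.
    The endpoints x and y are not ordered: taking (a, b) and then (b, a) covers
    both halves of [a, b]. *)
Lemma segment_half_bound (R : realType) (F f f' : R -> R)
    (x y q al be c A B : R) :
  1 <= q -> 0 <= al -> 0 <= be -> (1 - 1 / q) * al + be / q = 1 ->
  0 <= c <= 1 / 2 -> 0 < A -> 0 < B -> x != y ->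
  (forall t : R, 0 <= t <= 1 ->
    is_derive (x + t * (y - x)) 1 F (f (x + t * (y - x)))) ->
  (forall t : R, 0 <= t <= 1 ->
    is_derive (x + t * (y - x)) 1 f (f' (x + t * (y - x)))) ->
  (forall t : R, 0 <= t <= 1 ->
    `|f' (x + t * (y - x))| `^ q <= (1 - t) * A + t * B) ->
  `|(c * f x + (1 / 2 - c) * f ((x + y) / 2)) / (y - x)
    - (F ((x + y) / 2) - F x) / (y - x) ^+ 2|
  <= kernel_mass c al `^ (1 - 1 / q)
    * (A * (kernel_mass c be - kernel_moment c be) + B * kernel_moment c be)
      `^ (1 / q).
Proof.
move=> q1 al0 be0 albe c01 A0 B0 xy dF df hAB.
have yx0 : y - x != 0 by rewrite subr_eq0 eq_sym.
pose u : R -> R := fun t => x + t * (y - x).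
(* The two terms in f cancel in the derivative of P, which leaves (t - c) f'. *)
pose P : R -> R := fun t => (y - x)^-1 * ((t - c) * f (u t))
                            - ((y - x) ^+ 2)^-1 * F (u t).
have half01 (t : R) : 0 <= t <= 1 / 2 -> 0 <= t <= 1.
  by move=> /andP[t0 t1]; apply/andP; split; lra.
have derP (t : R) : 0 <= t <= 1 / 2 -> is_derive t 1 P ((t - c) * f' (u t)).
  move=> /half01 t01.
  have du : is_derive t 1 u (y - x).
    have H := is_deriveD (is_derive_cst x t 1)
      (is_deriveM (is_derive_id t 1) (is_derive_cst (y - x) t 1)).
    have E : y - x = 0 + (t *: 0 + (y - x) *: 1).
      by rewrite /GRing.scale/=; ring.
    rewrite [X in is_derive _ _ _ X]E; exact: H.
  have dFu := @is_derive1_comp R F u t _ _ (dF t t01) du.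
  have dfu := @is_derive1_comp R f u t _ _ (df t t01) du.
  have dk := is_deriveB (is_derive_id t 1) (is_derive_cst c t 1).
  have H := is_deriveB (is_deriveZ (y - x)^-1 (is_deriveM dk dfu))
                       (is_deriveZ ((y - x) ^+ 2)^-1 dFu).
  have E : (t - c) * f' (u t)
    = (y - x)^-1 *: ((t - c) *: (f' (u t) * (y - x)) + f (u t) *: (1 - 0))
      - ((y - x) ^+ 2)^-1 *: (f (u t) * (y - x)).
    by rewrite /GRing.scale/=; field.
  rewrite [X in is_derive _ _ _ X]E; exact: H.
have := half_bound q1 al0 be0 albe c01 A0 B0 derP
  (fun t t0 => hAB t (half01 t t0)).
have -> : P (1 / 2) - P 0 = (c * f x + (1 / 2 - c) * f ((x + y) / 2)) / (y - x)
    - (F ((x + y) / 2) - F x) / (y - x) ^+ 2.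
  rewrite /P /u mul0r addr0.
  have -> : x + 1 / 2 * (y - x) = (x + y) / 2 by field.
  by field.
by [].
Qed.

Lemma trapezoid_midpoint_bound (R : realType) (F f f' : R -> R)
    (a b q al be c A B : R) :
  1 <= q -> 0 <= al -> 0 <= be -> (1 - 1 / q) * al + be / q = 1 ->
  0 <= c <= 1 / 2 -> 0 < A -> 0 < B -> a < b ->
  (forall x : R, a <= x <= b -> is_derive x 1 F (f x)) ->
  (forall x : R, a <= x <= b -> is_derive x 1 f (f' x)) ->
  (forall t : R, 0 <= t <= 1 ->
    `|f' ((1 - t) * a + t * b)| `^ q <= (1 - t) * A + t * B) ->
  `|c * (f a + f b) + (1 - 2 * c) * f ((a + b) / 2) - (F b - F a) / (b - a)|
  <= (b - a) * (kernel_mass c al `^ (1 - 1 / q)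
    * ((A * (kernel_mass c be - kernel_moment c be)
         + B * kernel_moment c be) `^ (1 / q)
       + (B * (kernel_mass c be - kernel_moment c be)
         + A * kernel_moment c be) `^ (1 / q))).
Proof.
move=> q1 al0 be0 albe c01 A0 B0 ab dF df hAB.
have ba0 : 0 < b - a by rewrite subr_gt0.
have segl (t : R) : 0 <= t <= 1 -> a <= a + t * (b - a) <= b.
  by move=> /andP[t0 t1]; apply/andP; split; nra.
have segr (t : R) : 0 <= t <= 1 -> a <= b + t * (a - b) <= b.
  by move=> /andP[t0 t1]; apply/andP; split; nra.
have hl (t : R) : 0 <= t <= 1 ->
    `|f' (a + t * (b - a))| `^ q <= (1 - t) * A + t * B.
  have -> : a + t * (b - a) = (1 - t) * a + t * b by ring.
  exact: hAB.
have hr (t : R) : 0 <= t <= 1 ->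
    `|f' (b + t * (a - b))| `^ q <= (1 - t) * B + t * A.
  move=> /andP[t0 t1].
  have -> : b + t * (a - b) = (1 - (1 - t)) * a + (1 - t) * b by ring.
  have -> : (1 - t) * B + t * A = (1 - (1 - t)) * A + (1 - t) * B by ring.
  by apply: hAB; apply/andP; split; lra.
have L := segment_half_bound q1 al0 be0 albe c01 A0 B0 (negbT (lt_eqF ab))
  (fun t t01 => dF _ (segl t t01)) (fun t t01 => df _ (segl t t01)) hl.
have U := segment_half_bound q1 al0 be0 albe c01 B0 A0 (negbT (gt_eqF ab))
  (fun t t01 => dF _ (segr t t01)) (fun t t01 => df _ (segr t t01)) hr.
rewrite (addrC b a) in U.
have -> : c * (f a + f b) + (1 - 2 * c) * f ((a + b) / 2)
          - (F b - F a) / (b - a)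
  = (b - a) * (((c * f a + (1 / 2 - c) * f ((a + b) / 2)) / (b - a)
                - (F ((a + b) / 2) - F a) / (b - a) ^+ 2)
               - ((c * f b + (1 / 2 - c) * f ((a + b) / 2)) / (a - b)
                  - (F ((a + b) / 2) - F b) / (a - b) ^+ 2)).
  have ne1 : b - a != 0 by rewrite gt_eqF.
  have ne2 : a - b != 0 by rewrite lt_eqF// subr_lt0.
  by field; rewrite ?ne1 ?ne2.
rewrite normrM gtr0_norm// ler_wpM2l ?(ltW ba0)// mulrDr.
by rewrite (le_trans (ler_normB _ _))// lerD.
Qed.

(** For r <= 0, x ^ r = exp (r ln x) is convex because ln is concave, r <= 0
    reverses that inequality, and exp is convex and increasing. *)
Lemma powR_convex (R : realType) (r x y t : R) : r <= 0 \/ 1 <= r ->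
  0 < x -> 0 < y -> 0 <= t <= 1 ->
  ((1 - t) * x + t * y) `^ r <= (1 - t) * x `^ r + t * y `^ r.
Proof.
move=> hr x0 y0 /andP[t0 t1].
pose k : {i01 R} := Itv01 t0 t1.
have E (u v : R) : (1 - t) * u + t * v = conv k (v : R^o) (u : R^o).
  by rewrite addrC.
rewrite !E; case: hr => [r0|r1]; last first.
  by apply: convex_powR => //; rewrite inE/= in_itv/= ltW.
have c0 : 0 < conv k (y : R^o) (x : R^o) by exact: convR_gt0.
rewrite {1 2 3}/powR !gt_eqF//.
apply: le_trans (convex_expR k (r * ln y) (r * ln x)).
rewrite ler_expR.
have -> : conv k (r * ln y : R^o) (r * ln x : R^o)
          = r * conv k (ln y : R^o) (ln x : R^o).
  by rewrite !convRE; ring.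
by rewrite ler_wnM2l// concave_ln.
Qed.

Lemma powR_trapezoid_midpoint_bound (R : realType) (F : R -> R)
    (a b q al be c s : R) :
  1 <= q -> 0 <= al -> 0 <= be -> (1 - 1 / q) * al + be / q = 1 ->
  0 <= c <= 1 / 2 -> 0 < a -> a < b -> s != 0 ->
  (s - 1) * q <= 0 \/ 1 <= (s - 1) * q ->
  (forall x : R, 0 < x -> is_derive x 1 F (x `^ s)) ->
  `|c * (a `^ s + b `^ s) + (1 - 2 * c) * ((a + b) / 2) `^ s
    - (F b - F a) / (b - a)|
  <= (b - a) * `|s| * (kernel_mass c al `^ (1 - 1 / q)
    * ((a `^ ((s - 1) * q) * (kernel_mass c be - kernel_moment c be)
         + b `^ ((s - 1) * q) * kernel_moment c be) `^ (1 / q)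
       + (b `^ ((s - 1) * q) * (kernel_mass c be - kernel_moment c be)
         + a `^ ((s - 1) * q) * kernel_moment c be) `^ (1 / q))).
Proof.
move=> q1 al0 be0 albe c01 a0 ab s0 hr dF.
have /andP[c0 c1] := c01.
have q0 : 0 < q by exact: lt_le_trans q1.
have b0 : 0 < b by exact: lt_trans ab.
have ns0 : 0 < `|s| by rewrite normr_gt0.
have mom0 := kernel_moment_ge0 c0 be0.
have com0 := kernel_comoment_ge0 c01 be0.
have pos (x : R) : a <= x <= b -> 0 < x.
  by move=> /andP[ax _]; exact: lt_le_trans ax.
have scale (x : R) : 0 <= x ->
    (`|s| * x `^ (s - 1)) `^ q = `|s| `^ q * x `^ ((s - 1) * q).
  by move=> x0; rewrite powRM ?powR_ge0// -powRrM.
have := @trapezoid_midpoint_bound R F (fun x => x `^ s)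
  (fun x => s * x `^ (s - 1)) a b q al be c
  (`|s| `^ q * a `^ ((s - 1) * q)) (`|s| `^ q * b `^ ((s - 1) * q))
  q1 al0 be0 albe c01.
rewrite !mulr_gt0 ?powR_gt0// => /(_ isT isT ab).
have hF (x : R) : a <= x <= b -> is_derive x 1 F (x `^ s).
  by move=> /pos; exact: dF.
have hf (x : R) : a <= x <= b ->
    is_derive x 1 (fun x : R => x `^ s) (s * x `^ (s - 1)).
  by move=> /pos; exact: is_derive1_powR.
move=> /(_ hF hf) H; apply: le_trans (H _) _.
  move=> t t01; rewrite normrM (ger0_norm (powR_ge0 _ _)) scale; last first.
    by case/andP: t01 => ? ?; rewrite addr_ge0// mulr_ge0 ?subr_ge0// ltW.
  rewrite !(mulrCA _ (`|s| `^ q)) -mulrDr ler_wpM2l ?powR_ge0//.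
  exact: powR_convex.
have fact (u v : R) : 0 <= u -> 0 <= v ->
    (`|s| `^ q * u * (kernel_mass c be - kernel_moment c be)
     + `|s| `^ q * v * kernel_moment c be) `^ (1 / q)
    = `|s| * (u * (kernel_mass c be - kernel_moment c be)
              + v * kernel_moment c be) `^ (1 / q).
  move=> u0 v0; rewrite -!mulrA -mulrDr powRM ?powR_ge0//; last first.
    by rewrite addr_ge0// mulr_ge0.
  by rewrite -powRrM div1r mulfV ?gt_eqF// powRr1.
by rewrite !fact ?powR_ge0// -mulrDr [X in (b - a) * X <= _]mulrCA
  [X in X <= _]mulrA.
Qed.

(** * The generalized logarithmic mean *)

(** The s-th power of the mean is the average of x ^ s over [a, b]; the case
    s = -1 is the one where the primitive is a logarithm. *)
Lemma gen_log_mean_powRE (R : realType) (a b s : R) : 0 < a -> a < b ->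
  s != 0 ->
  exists2 F : R -> R, (forall x : R, 0 < x -> is_derive x 1 F (x `^ s))
    & gen_log_mean s a b `^ s = (F b - F a) / (b - a).
Proof.
move=> a0 ab s0; have b0 : 0 < b by exact: lt_trans ab.
have ba0 : 0 < b - a by rewrite subr_gt0.
rewrite /gen_log_mean lt_eqF//.
have [->|s1] := eqVneq s (-1).
  exists (@ln R).
    by move=> x x0; rewrite powR_inv1 ?(ltW x0)//; exact: is_derive1_ln.
  rewrite /log_mean lt_eqF// powR_inv1 ?invf_div//.
  by rewrite divr_ge0 ?(ltW ba0)// subr_ge0 ler_ln// ltW.
have s10 : s + 1 != 0 by rewrite addr_eq0.
have dF (x : R) : 0 < x ->
    is_derive x 1 (fun x : R => (s + 1)^-1 * x `^ (s + 1)) (x `^ s).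
  move=> x0; have H := is_deriveZ (s + 1)^-1 (is_derive1_powR (s + 1) x0).
  rewrite [X in is_derive _ _ _ X]
    (_ : _ = (s + 1)^-1 *: ((s + 1) * x `^ (s + 1 - 1)))//.
  by rewrite addrK /GRing.scale/= mulrA mulVf// mul1r.
exists (fun x => (s + 1)^-1 * x `^ (s + 1)) => //.
rewrite (negbTE s0).
have -> : (b `^ (s + 1) - a `^ (s + 1)) / ((s + 1) * (b - a))
        = ((s + 1)^-1 * b `^ (s + 1) - (s + 1)^-1 * a `^ (s + 1)) / (b - a).
  by field; rewrite s10 gt_eqF.
rewrite -powRrM div1r mulVf// powRr1//.
have cF : {within `[a, b],
    continuous (fun x => (s + 1)^-1 * x `^ (s + 1))}%classic.
  apply: derivable_within_continuous => x; rewrite in_itv/= => /andP[ax _].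
  by have [] := dF x (lt_le_trans a0 ax).
have dF' (x : R) : x \in `]a, b[ ->
    is_derive x 1 (fun x : R => (s + 1)^-1 * x `^ (s + 1)) (x `^ s).
  by rewrite in_itv/= => /andP[ax _]; exact: (dF x (lt_trans a0 ax)).
have [x _ ->] := MVT ab dF' cF.
by rewrite mulfK ?gt_eqF// powR_ge0.
Qed.

(** The hypotheses on s keep the exponent of |f'| ^ q out of ]0, 1[, where
    powers are concave. *)
Lemma powR_exponent_convex (R : realType) (q s : R) : 1 <= q ->
  (1 < s /\ 1 <= (s - 1) * q) \/ (s < 1 /\ s <> 0) ->
  s != 0 /\ ((s - 1) * q <= 0 \/ 1 <= (s - 1) * q).
Proof.
move=> q1 [[s1 sq]|[s1 /eqP s0]]; split=> //.
- by rewrite gt_eqF// (lt_trans ltr01).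
- by right.
- by left; rewrite mulr_le0_ge0// ?subr_le0 ?ltW// (lt_le_trans ltr01).
Qed.

Lemma gen_log_mean_bound (R : realType) (a b q al be m l s : R) :
  1 <= q -> 0 <= al -> 0 <= be -> (1 - 1 / q) * al + be / q = 1 ->
  0 < a -> a < b -> 0 < m -> 2 * l <= m -> 0 <= 2 * l ->
  (1 < s /\ 1 <= (s - 1) * q) \/ (s < 1 /\ s <> 0) ->
  `|(2 * l * arith_mean (a `^ s) (b `^ s)
     + (m - 2 * l) * (arith_mean a b) `^ s) / m
    - (gen_log_mean s a b) `^ s|
  <= (b - a) * `|s| * (kernel_mass (l / m) al `^ (1 - 1 / q)
    * ((kernel_moment (l / m) be * a `^ ((s - 1) * q)
        + (kernel_mass (l / m) be - kernel_moment (l / m) be)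
          * b `^ ((s - 1) * q)) `^ (1 / q)
       + ((kernel_mass (l / m) be - kernel_moment (l / m) be)
          * a `^ ((s - 1) * q)
          + kernel_moment (l / m) be * b `^ ((s - 1) * q)) `^ (1 / q))).
Proof.
move=> q1 al0 be0 albe a0 ab m0 hml hl hs.
have [s0 hr] := powR_exponent_convex q1 hs.
have [F dF ->] := gen_log_mean_powRE a0 ab s0.
have c01 : 0 <= l / m <= 1 / 2.
  by rewrite divr_ge0 ?(ltW m0)/= ?ler_pdivrMr//; lra.
have := powR_trapezoid_midpoint_bound q1 al0 be0 albe c01 a0 ab s0 hr dF.
set M := kernel_moment _ _; set N := kernel_mass _ be - M.
have -> : l / m * (a `^ s + b `^ s) + (1 - 2 * (l / m)) * ((a + b) / 2) `^ s
  = (2 * l * arith_mean (a `^ s) (b `^ s)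
     + (m - 2 * l) * arith_mean a b `^ s) / m.
  by rewrite /arith_mean; field; rewrite gt_eqF.
move=> /le_trans; apply; rewrite le_eqVlt; apply/orP; left; apply/eqP.
rewrite [X in _ * (_ * X)]addrC.
by congr (_ * (_ * (_ `^ _ + _ `^ _))); ring.
Qed.

(** The common factor K of the two integrals comes out with exponent
    (1 - 1/q) + 1/q = 1. *)
Lemma powR_regroup (R : realType) (q S T K U : R) : 1 <= q ->
  0 <= S -> 0 <= T -> 0 < K -> 0 <= U ->
  (S * K) `^ (1 - 1 / q) * (T * K * U) `^ (1 / q)
  = K * S `^ (1 - 1 / q) * T `^ (1 / q) * U `^ (1 / q).
Proof.
move=> q1 S0 T0 K0 U0; have K0' := ltW K0.
rewrite !powRM ?mulr_ge0//.
have {3}-> : K = K `^ (1 - 1 / q) * K `^ (1 / q).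
  by rewrite -powRD ?(gt_eqF K0) ?implybT// subrK powRr1.
ring.
Qed.

Lemma powR_nat_exponent (R : realType) (x : R) : 0 <= x ->
  (x `^ (1 + 1) = x * x) * (x `^ (1 + 2) = x * x * x).
Proof.
move=> x0; split; first by rewrite powRS// powRr1.
have -> : 1 + 2 = 1 + 1 + 1 :> R by ring.
by rewrite !powRS// powRr1.
Qed.

(** * Values of the moments for c = l / m *)
Section kernel_values.
Context {R : realType}.
Variables (m l q : R).
Hypotheses (m0 : 0 < m) (hml : 2 * l <= m) (hl : 0 <= 2 * l) (hq : 0 <= q).

Let c0 : 0 <= l / m.
Proof. by rewrite divr_ge0 ?(ltW m0)//; move: hl; lra. Qed.

Let w0 : 0 <= 1 / 2 - l / m.
Proof. by rewrite subr_ge0 ler_pdivrMr//; move: hml; lra. Qed.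

Lemma kernel_mass0 : kernel_mass (l / m) 0 = 1 / 2.
Proof. by rewrite /kernel_mass add0r !powRr1// subrKC divr1. Qed.

Lemma kernel_mass1 :
  kernel_mass (l / m) 1
  = (4 * l ^+ 2 + (m - 2 * l) ^+ 2) * (1 / (8 * m ^+ 2)).
Proof.
rewrite /kernel_mass !powR_nat_exponent//.
by field; rewrite gt_eqF.
Qed.

Lemma kernel_moment1 :
  kernel_moment (l / m) 1
  = 1 / (3 * m) * (1 / (8 * m ^+ 2))
    * (4 * l ^+ 3 + (m + l) * (m - 2 * l) ^+ 2).
Proof.
rewrite /kernel_moment !powR_nat_exponent//.
by field; rewrite gt_eqF.
Qed.

Lemma kernel_comoment1 :
  kernel_mass (l / m) 1 - kernel_moment (l / m) 1
  = 1 / (3 * m) * (1 / (8 * m ^+ 2))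
    * (4 * (3 * m - l) * l ^+ 2 + (2 * m - l) * (m - 2 * l) ^+ 2).
Proof. by rewrite kernel_mass1 kernel_moment1; field; rewrite gt_eqF. Qed.

Let q1 : 0 <= q + 1.
Proof. by rewrite addr_ge0. Qed.

Let powR_rescale (x : R) : 0 <= x ->
  (x / (2 * m)) `^ (q + 1) = x `^ (q + 1) * (1 / (2 * m)) `^ q / (2 * m).
Proof.
move=> x0; have k0 : 0 <= 1 / (2 * m) by rewrite divr_ge0 ?mulr_ge0 ?(ltW m0).
have {1}-> : x / (2 * m) = x * (1 / (2 * m)) by rewrite div1r.
by rewrite powRM// (powRS k0 hq) div1r mulrA.
Qed.

Let cE : l / m = 2 * l / (2 * m).
Proof. by field; rewrite gt_eqF. Qed.

Let wE : 1 / 2 - l / m = (m - 2 * l) / (2 * m).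
Proof. by field; rewrite gt_eqF. Qed.

Let ml0 : 0 <= m - 2 * l. Proof. by rewrite subr_ge0. Qed.

Lemma kernel_moment_ratio :
  kernel_moment (l / m) q
  = 1 / (2 * m ^+ 2 * (q + 1) * (q + 2)) * (1 / (2 * m)) `^ q * (1 / 2)
    * ((2 * l) `^ (q + 2)
       + (m * q + m + 2 * l) * (m - 2 * l) `^ (q + 1)).
Proof.
rewrite /kernel_moment.
have q2 : q + 2 = q + 1 + 1 by ring.
rewrite q2 !(powRS _ q1)// wE {1}cE !powR_rescale// -q2.
field.
by rewrite !gt_eqF// ?ltr_wpDl.
Qed.

Lemma kernel_comoment_ratio :
  kernel_mass (l / m) q - kernel_moment (l / m) q
  = 1 / (2 * m ^+ 2 * (q + 1) * (q + 2)) * (1 / (2 * m)) `^ q * (1 / 2)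
    * ((2 * m * q + 4 * m - 2 * l) * (2 * l) `^ (q + 1)
       + (m * q + 3 * m - 2 * l) * (m - 2 * l) `^ (q + 1)).
Proof.
rewrite kernel_comomentE// wE {1}cE !powR_rescale//.
field.
by rewrite !gt_eqF// ?ltr_wpDl.
Qed.

End kernel_values.

(** * The estimates *)

(** The splitting al = be = 1. *)
Lemma gen_log_mean_power_mean_bound (R : realType) (a b q m l s : R) :
  0 < a -> a < b -> 1 <= q -> 0 < m -> 2 * l <= m -> 0 <= 2 * l ->
  (1 < s /\ 1 <= (s - 1) * q) \/ (s < 1 /\ s <> 0) ->
  `|(2 * l * arith_mean (a `^ s) (b `^ s)
     + (m - 2 * l) * (arith_mean a b) `^ s) / m
    - (gen_log_mean s a b) `^ s|
  <= (b - a) / (8 * m ^+ 2) * (1 / (3 * m)) `^ (1 / q)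
     * (4 * l ^+ 2 + (m - 2 * l) ^+ 2) `^ (1 - 1 / q) * `|s| *
     (((4 * l ^+ 3 + (m + l) * (m - 2 * l) ^+ 2)
        * (a `^ ((s - 1) * q))
      + (4 * (3 * m - l) * l ^+ 2 + (2 * m - l) * (m - 2 * l) ^+ 2)
        * (b `^ ((s - 1) * q))) `^ (1 / q)
      + ((4 * (3 * m - l) * l ^+ 2 + (2 * m - l) * (m - 2 * l) ^+ 2)
        * (a `^ ((s - 1) * q))
      + (4 * l ^+ 3 + (m + l) * (m - 2 * l) ^+ 2)
        * (b `^ ((s - 1) * q))) `^ (1 / q)).
Proof.
move=> a0 ab q1 m0 hml hl hs.
have rel : (1 - 1 / q) * 1 + 1 / q = 1 by rewrite mulr1 subrK.
apply: le_trans (gen_log_mean_bound q1 ler01 ler01 rel a0 ab m0 hml hl hs) _.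
have l0 : 0 <= l by lra.
rewrite kernel_comoment1// kernel_moment1// kernel_mass1//.
set S := 4 * l ^+ 2 + _; set T := 1 / (3 * m); set K := 1 / (8 * m ^+ 2).
set N1 := _ + (m + l) * _; set N2 := _ + (2 * m - l) * _.
have S0 : 0 <= S by rewrite addr_ge0 ?sqr_ge0// mulr_ge0 ?sqr_ge0.
have T0 : 0 <= T by rewrite divr_ge0 ?mulr_ge0 ?ltW.
have K0 : 0 < K by rewrite divr_gt0 ?mulr_gt0 ?exprn_gt0.
have N10 : 0 <= N1.
  by apply: addr_ge0; apply: mulr_ge0; rewrite ?exprn_ge0 ?sqr_ge0//; lra.
have N20 : 0 <= N2.
  by apply: addr_ge0; apply: mulr_ge0; rewrite ?sqr_ge0//; lra.
have comb0 (u v : R) : 0 <= u -> 0 <= v ->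
    0 <= u * a `^ ((s - 1) * q) + v * b `^ ((s - 1) * q).
  by move=> u0 v0; apply: addr_ge0; apply: mulr_ge0; rewrite ?powR_ge0.
have U0 := comb0 _ _ N10 N20; have V0 := comb0 _ _ N20 N10.
rewrite -!(mulrA (T * K)) -!(mulrDr (T * K)) [X in _ * X <= _]mulrDr.
rewrite !powR_regroup//.
have -> : (b - a) / (8 * m ^+ 2) = (b - a) * K by rewrite /K div1r.
by rewrite le_eqVlt; apply/orP; left; apply/eqP; ring.
Qed.

(** The splitting al = 0 and be = q: the first factor of Hoelder's inequality
    is then the length 1/2 of the interval. *)
Lemma gen_log_mean_hoelder_bound (R : realType) (a b q m l s : R) :
  0 < a -> a < b -> 1 <= q -> 0 < m -> 2 * l <= m -> 0 <= 2 * l ->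
  (1 < s /\ 1 <= (s - 1) * q) \/ (s < 1 /\ s <> 0) ->
  `|(2 * l * arith_mean (a `^ s) (b `^ s)
     + (m - 2 * l) * (arith_mean a b) `^ s) / m
    - (gen_log_mean s a b) `^ s|
  <= (b - a) / (4 * m) * `|s|
     * (1 / (2 * m ^+ 2 * (q + 1) * (q + 2))) `^ (1 / q) *
     ((((2 * l) `^ (q + 2)
         + (m * q + m + 2 * l) * (m - 2 * l) `^ (q + 1))
        * (a `^ ((s - 1) * q))
      + ((2 * m * q + 4 * m - 2 * l) * (2 * l) `^ (q + 1)
         + (m * q + 3 * m - 2 * l) * (m - 2 * l) `^ (q + 1))
        * (b `^ ((s - 1) * q))) `^ (1 / q)
      + (((2 * m * q + 4 * m - 2 * l) * (2 * l) `^ (q + 1)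
         + (m * q + 3 * m - 2 * l) * (m - 2 * l) `^ (q + 1))
        * (a `^ ((s - 1) * q))
      + ((2 * l) `^ (q + 2)
         + (m * q + m + 2 * l) * (m - 2 * l) `^ (q + 1))
        * (b `^ ((s - 1) * q))) `^ (1 / q)).
Proof.
move=> a0 ab q1 m0 hml hl hs.
have q0 : 0 < q by exact: lt_le_trans q1.
have q0' := ltW q0.
have rel : (1 - 1 / q) * 0 + q / q = 1 by rewrite mulr0 add0r divff ?gt_eqF.
apply: le_trans (gen_log_mean_bound q1 (lexx 0) q0' rel a0 ab m0 hml hl hs) _.
rewrite kernel_comoment_ratio// kernel_moment_ratio// kernel_mass0//.
(* Both moments contain the factor k ^ q, which the exponent 1 / q turns into
   k; together with the length 1 / 2 it makes the constant 1 / (4 m). *)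
set T := 1 / (2 * m ^+ 2 * (q + 1) * (q + 2)); set k := 1 / (2 * m).
set N1 := _ + (m * q + m + 2 * l) * _.
set N2 := _ + (m * q + 3 * m - 2 * l) * _.
have mq0 : 0 <= m * q by rewrite mulr_ge0 ?(ltW m0).
have k0 : 0 <= k by rewrite divr_ge0 ?mulr_ge0 ?(ltW m0).
have T0 : 0 <= T by rewrite divr_ge0 ?mulr_ge0 ?exprn_ge0 ?addr_ge0 ?(ltW m0).
have N10 : 0 <= N1.
  by rewrite addr_ge0 ?mulr_ge0 ?powR_ge0// !addr_ge0 ?(ltW m0).
have N20 : 0 <= N2.
  by rewrite addr_ge0 ?mulr_ge0 ?powR_ge0//; lra.
have half0 : 0 < 1 / 2 :> R by rewrite divr_gt0.
have comb0 (u v : R) : 0 <= u -> 0 <= v ->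
    0 <= u * a `^ ((s - 1) * q) + v * b `^ ((s - 1) * q).
  by move=> u0 v0; apply: addr_ge0; apply: mulr_ge0; rewrite ?powR_ge0.
have U0 := comb0 _ _ N10 N20; have V0 := comb0 _ _ N20 N10.
have Tk0 : 0 <= T * k `^ q by rewrite mulr_ge0 ?powR_ge0.
rewrite -!(mulrA (T * k `^ q * (1 / 2))) -!(mulrDr (T * k `^ q * (1 / 2))).
rewrite -[X in X `^ (1 - 1 / q)]mul1r [X in _ * X <= _]mulrDr.
rewrite !powR_regroup// powR1 (powRM _ T0 (powR_ge0 k q)).
have -> : (k `^ q) `^ (1 / q) = k.
  by rewrite -powRrM div1r mulfV ?gt_eqF// powRr1.
have -> : (b - a) / (4 * m) = (b - a) * (1 / 2) * k.
  by rewrite /k; field; rewrite gt_eqF.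
by rewrite le_eqVlt; apply/orP; left; apply/eqP; ring.
Qed.

(** For q = 1 the two brackets of the power mean bound add up to
    3 m (4 l ^ 2 + (m - 2 l) ^ 2) (a ^ (s - 1) + b ^ (s - 1)). *)
Lemma gen_log_mean_linear_bound (R : realType) (a b m l s : R) :
  0 < a -> a < b -> 0 < m -> 2 * l <= m -> 0 <= 2 * l ->
  2 <= s \/ (s < 1 /\ s <> 0) ->
  `|(2 * l * arith_mean (a `^ s) (b `^ s)
     + (m - 2 * l) * (arith_mean a b) `^ s) / m
    - (gen_log_mean s a b) `^ s|
  <= (b - a) / (4 * m ^+ 2) * `|s|
     * (4 * l ^+ 2 + (m - 2 * l) ^+ 2)
     * arith_mean (a `^ (s - 1)) (b `^ (s - 1)).
Proof.
move=> a0 ab m0 hml hl hs.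
have hs1 : (1 < s /\ 1 <= (s - 1) * 1) \/ (s < 1 /\ s <> 0).
  by case: hs => [s2|]; [left; rewrite mulr1; split; lra|right].
have l0 : 0 <= l by lra.
have m0' := ltW m0.
apply: le_trans (gen_log_mean_power_mean_bound a0 ab (lexx 1) m0 hml hl hs1) _.
have N10 : 0 <= 4 * l ^+ 3 + (m + l) * (m - 2 * l) ^+ 2.
  by apply: addr_ge0; apply: mulr_ge0; rewrite ?exprn_ge0 ?sqr_ge0//; lra.
have N20 : 0 <= 4 * (3 * m - l) * l ^+ 2 + (2 * m - l) * (m - 2 * l) ^+ 2.
  by apply: addr_ge0; apply: mulr_ge0; rewrite ?sqr_ge0//; lra.
have T0 : 0 <= 1 / (3 * m) by rewrite divr_ge0 ?mulr_ge0.
rewrite !divr1 subrr powRr0 mulr1 !mulr1.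
rewrite !powRr1 ?addr_ge0 ?(mulr_ge0 _ (powR_ge0 _ _))//.
rewrite le_eqVlt; apply/orP; left; apply/eqP.
by rewrite /arith_mean; field; rewrite gt_eqF.
Qed.

(** At s = -1 all the means turn into their reciprocals, the arithmetic mean of
    1 / a and 1 / b being 1 / H. *)
Lemma mean_powRN1 (R : realType) (a b m l : R) : 0 < a -> a < b -> 0 < m ->
  (2 * l * arith_mean (a `^ (-1)) (b `^ (-1))
     + (m - 2 * l) * (arith_mean a b) `^ (-1)) / m
    - (gen_log_mean (-1) a b) `^ (-1)
  = 1 / m * (2 * l / harm_mean a b + (m - 2 * l) / arith_mean a b)
    - 1 / log_mean a b.
Proof.
move=> a0 ab m0; have b0 : 0 < b by exact: lt_trans ab.
have ab0 : 0 < a + b by rewrite addr_gt0.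
have L0 : 0 <= log_mean a b.
  by rewrite /log_mean lt_eqF// divr_ge0// subr_ge0 ?ler_ln// ltW.
rewrite /gen_log_mean lt_eqF// eqxx.
rewrite !powR_inv1 ?divr_ge0 ?(ltW ab0) ?(ltW a0) ?(ltW b0)//.
congr (_ - _); last by rewrite div1r.
by rewrite /arith_mean /harm_mean; field; rewrite !gt_eqF.
Qed.

Theorem theorem4p2 (R : realType) (a b q m l s : R)
    (ha : 0 < a) (hab : a < b) (hq : 1 <= q)
    (hm : 0 < m) (hml : 2 * l <= m) (hl : 0 <= 2 * l) :
  [/\ ((1 < s /\ 1 <= (s - 1) * q) \/ (s < 1 /\ s <> 0) ->
        `|(2 * l * arith_mean (a `^ s) (b `^ s)
           + (m - 2 * l) * (arith_mean a b) `^ s) / m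
          - (gen_log_mean s a b) `^ s|
        <= (b - a) / (8 * m ^+ 2) * (1 / (3 * m)) `^ (1 / q)
           * (4 * l ^+ 2 + (m - 2 * l) ^+ 2) `^ (1 - 1 / q) * `|s| *
           (((4 * l ^+ 3 + (m + l) * (m - 2 * l) ^+ 2)
              * (a `^ ((s - 1) * q))
            + (4 * (3 * m - l) * l ^+ 2 + (2 * m - l) * (m - 2 * l) ^+ 2)
              * (b `^ ((s - 1) * q))) `^ (1 / q)
            + ((4 * (3 * m - l) * l ^+ 2 + (2 * m - l) * (m - 2 * l) ^+ 2)
              * (a `^ ((s - 1) * q))
            + (4 * l ^+ 3 + (m + l) * (m - 2 * l) ^+ 2)
              * (b `^ ((s - 1) * q))) `^ (1 / q))
        /\
        `|(2 * l * arith_mean (a `^ s) (b `^ s)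
           + (m - 2 * l) * (arith_mean a b) `^ s) / m
          - (gen_log_mean s a b) `^ s|
        <= (b - a) / (4 * m) * `|s|
           * (1 / (2 * m ^+ 2 * (q + 1) * (q + 2))) `^ (1 / q) *
           ((((2 * l) `^ (q + 2)
               + (m * q + m + 2 * l) * (m - 2 * l) `^ (q + 1))
              * (a `^ ((s - 1) * q))
            + ((2 * m * q + 4 * m - 2 * l) * (2 * l) `^ (q + 1)
               + (m * q + 3 * m - 2 * l) * (m - 2 * l) `^ (q + 1))
              * (b `^ ((s - 1) * q))) `^ (1 / q)
            + (((2 * m * q + 4 * m - 2 * l) * (2 * l) `^ (q + 1)
               + (m * q + 3 * m - 2 * l) * (m - 2 * l) `^ (q + 1))
              * (a `^ ((s - 1) * q))
            + ((2 * l) `^ (q + 2)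
               + (m * q + m + 2 * l) * (m - 2 * l) `^ (q + 1))
              * (b `^ ((s - 1) * q))) `^ (1 / q))),
      (s = -1 ->
        `|1 / m * (2 * l / harm_mean a b + (m - 2 * l) / arith_mean a b)
          - 1 / log_mean a b|
        <= (b - a) / (8 * m ^+ 2) * (1 / (3 * m)) `^ (1 / q)
           * (4 * l ^+ 2 + (m - 2 * l) ^+ 2) `^ (1 - 1 / q) *
           (((4 * l ^+ 3 + (m + l) * (m - 2 * l) ^+ 2)
              / (a `^ (2 * q))
            + (4 * (3 * m - l) * l ^+ 2 + (2 * m - l) * (m - 2 * l) ^+ 2)
              / (b `^ (2 * q))) `^ (1 / q)
            + ((4 * (3 * m - l) * l ^+ 2 + (2 * m - l) * (m - 2 * l) ^+ 2)
              / (a `^ (2 * q))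
            + (4 * l ^+ 3 + (m + l) * (m - 2 * l) ^+ 2)
              / (b `^ (2 * q))) `^ (1 / q))
        /\
        `|1 / m * (2 * l / harm_mean a b + (m - 2 * l) / arith_mean a b)
          - 1 / log_mean a b|
        <= (b - a) / (4 * m)
           * (1 / (2 * m ^+ 2 * (q + 1) * (q + 2))) `^ (1 / q) *
           ((((2 * l) `^ (q + 2)
               + (m * q + m + 2 * l) * (m - 2 * l) `^ (q + 1))
              / (a `^ (2 * q))
            + ((m * q + 3 * m - 2 * l) * (m - 2 * l) `^ (q + 1)
               + (2 * m * q + 4 * m - 2 * l) * (2 * l) `^ (q + 1))
              / (b `^ (2 * q))) `^ (1 / q)
            + (((m * q + 3 * m - 2 * l) * (m - 2 * l) `^ (q + 1)
               + (2 * m * q + 4 * m - 2 * l) * (2 * l) `^ (q + 1))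
              / (a `^ (2 * q))
            + ((2 * l) `^ (q + 2)
               + (m * q + m + 2 * l) * (m - 2 * l) `^ (q + 1))
              / (b `^ (2 * q))) `^ (1 / q))),
      (2 <= s \/ (s < 1 /\ s <> 0) ->
        `|(2 * l * arith_mean (a `^ s) (b `^ s)
           + (m - 2 * l) * (arith_mean a b) `^ s) / m
          - (gen_log_mean s a b) `^ s|
        <= (b - a) / (4 * m ^+ 2) * `|s|
           * (4 * l ^+ 2 + (m - 2 * l) ^+ 2)
           * arith_mean (a `^ (s - 1)) (b `^ (s - 1)))
    & `|1 / m * (2 * l / harm_mean a b + (m - 2 * l) / arith_mean a b)
        - 1 / log_mean a b|
      <= (b - a) / (4 * m ^+ 2)
         * ((4 * l ^+ 2 + (m - 2 * l) ^+ 2) / harm_mean (a ^+ 2) (b ^+ 2))].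
Proof.
have N1lt1 : (-1 < 1 :> R /\ -1 <> 0 :> R).
  by split; [lra|apply/eqP; rewrite oppr_eq0 oner_eq0].
have powN2 (x : R) : x `^ ((-1 - 1) * q) = (x `^ (2 * q))^-1.
  by rewrite -powRN; congr (_ `^ _); ring.
split.
- move=> hs; split.
    exact: gen_log_mean_power_mean_bound.
  exact: gen_log_mean_hoelder_bound.
- move=> _; rewrite -mean_powRN1//; split.
    have := gen_log_mean_power_mean_bound ha hab hq hm hml hl (or_intror N1lt1).
    by rewrite normrN1 mulr1 !powN2.
  have := gen_log_mean_hoelder_bound ha hab hq hm hml hl (or_intror N1lt1).
  rewrite normrN1 mulr1 !powN2.
  by rewrite (addrC ((2 * m * q + 4 * m - 2 * l) * (2 * l) `^ (q + 1))).
- by move=> hs; exact: gen_log_mean_linear_bound.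
- rewrite -mean_powRN1//.
  have := gen_log_mean_linear_bound ha hab hm hml hl (or_intror N1lt1).
  have hb : 0 < b by exact: lt_trans hab.
  have powN2n (x : R) : 0 < x -> x `^ (-1 - 1) = (x ^+ 2)^-1.
    by move=> x0; rewrite -powR_invn ?(ltW x0)//; congr (_ `^ _); ring.
  move=> /le_trans; apply; rewrite le_eqVlt; apply/orP; left; apply/eqP.
  rewrite normrN1 !powN2n// /arith_mean /harm_mean.
  by field; rewrite !gt_eqF// addr_gt0// exprn_gt0.
Qed.
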